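(* Let $m\ge 1$ and consider the delay differential equation $$x'(t)+\sum_{i=1}^{m}p_i(t)\,x(\tau_i(t))=0,\qquad t\ge 0, \tag{E}$$ where, for $1\le i\le m$, $p_i:[0,\infty)\to[0,\infty)$, and $\tau_i:[0,\infty)\to\mathbb{R}$ (not assumed to be monotone) satisfies $\tau_i(t)<t$ for all $t\ge 0$ and $\lim_{t\to\infty}\tau_i(t)=\infty$. Put $\tau_{\max}(t)=\max_{1\le i\le m}\tau_i(t)$ and $$h(t)=\max_{1\le i\le m}h_i(t),\qquad h_i(t)=\sup_{0\le s\le t}\tau_i(s),\qquad t\ge 0,$$ and define recursively, for $r\in\mathbb{N}=\{1,2,\dots\}$, $$a_1(t,s)=\exp\left\{\int_s^t\sum_{i=1}^m p_i(\zeta)\,d\zeta\right\},\qquad a_{r+1}(t,s)=\exp\left\{\int_s^t\sum_{i=1}^m p_i(\zeta)\,a_r(\zeta,\tau_i(\zeta))\,d\zeta\right\}.$$ Assume that $$0<\alpha:=\liminf_{t\to\infty}\int_{\tau_{\max}(t)}^{t}\sum_{i=1}^m p_i(s)\,ds\le \frac1e,$$ and let $\lambda_0$ be the smaller real root of the equation $\lambda=e^{\alpha\lambda}$. If for some $r\in\mathbb{N}$ $$\limsup_{t\to\infty}\int_{h(t)}^{t}\sum_{i=1}^m p_i(\zeta)\,a_r(h(\zeta),\tau_i(\zeta))\,d\zeta>\frac{1+\ln\lambda_0}{\lambda_0},$$ then all solutions of (E) oscillate.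
   Context: Solutions: let $T_0\in[0,\infty)$, $\tau_{\min}(t)=\min_{1\le i\le m}\tau_i(t)$ and $\tau_{(-1)}(t)=\sup\{s\ge 0:\tau_{\min}(s)\le t\}$. A solution of (E) is a function $x\in C([T_0,\infty);\mathbb{R})$ (for some such $T_0$) that is continuously differentiable on $[\tau_{(-1)}(T_0),\infty)$ and satisfies (E) for all $t\ge\tau_{(-1)}(T_0)$. A solution is oscillatory (oscillates) if it is neither eventually positive nor eventually negative. Conventions: the functions $p_i,\tau_i$ are such that all integrals written are meaningful. Since $\tau_i(t)\to\infty$, for each fixed $r$ the quantities $a_r(t,s)$, $t\ge s$, are defined for all sufficiently large $s$, and only large $t$ matters in the $\liminf$ and $\limsup$. When $\alpha=1/e$, the equation $\lambda=e^{\alpha\lambda}$ has the single (double) root $\lambda_0=e$. *)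

(* Defs.v *)
From mathcomp Require Import all_boot all_order all_algebra.
From mathcomp Require Import all_classical all_reals all_analysis.
Set Implicit Arguments.
Unset Strict Implicit.
Unset Printing Implicit Defensive.
Import Order.TTheory GRing.Theory Num.Theory.
Import numFieldNormedType.Exports.
Local Open Scope classical_set_scope.
Local Open Scope ring_scope.

(* The delay equation x'(t) + \sum_(i < m.+1) p i t * x (tau i t) = 0, t >= 0,
   with m.+1 >= 1 terms. Functions on a half-line are represented by functions
   on R; their values off the half-line are irrelevant.

   Integrals are Lebesgue integrals, taken with respect to the completed
   Lebesgue measure so that integrands need only be Lebesgue (not Borel)
   measurable. *)

Section DelayEquation.
Context {R : realType} {m : nat}.
Implicit Types (p tau : 'I_m.+1 -> R -> R) (x : R -> R) (s t : R).

Local Notation mu := (@completed_lebesgue_measure R).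

Definition tau_max tau t : R :=
  \big[Num.max/tau ord0 t]_(i < m.+1) tau i t.

Definition tau_min tau t : R :=
  \big[Num.min/tau ord0 t]_(i < m.+1) tau i t.

Definition h_ tau (i : 'I_m.+1) t : R := sup [set tau i s | s in `[0, t]].

Definition h tau t : R := \big[Num.max/h_ tau ord0 t]_(i < m.+1) h_ tau i t.

(* With a 0 = 1 the recursion yields a 1 t s = exp (\int_s^t \sum_i p i). *)
Fixpoint a p tau (r : nat) t s : R :=
  match r with
  | 0%N => 1
  | r'.+1 => expR (\int[mu]_(z in `[s, t])
                     \sum_(i < m.+1) p i z * a p tau r' z (tau i z))
  end.

Definition integrable_on s t (f : R -> R) : Prop :=
  mu.-integrable `[s, t] (EFin \o f).

(* The integrals defining the [a r] and those in the limsup condition are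
   meaningful (i.e., finite). The bound on [s] depends on [r]: for small [s],
   the inner integrals may involve negative arguments. *)
Definition integrals_meaningful p tau : Prop :=
  forall r : nat,
    (\forall s \near +oo, forall t, s <= t ->
       integrable_on s t
         (fun z => \sum_(i < m.+1) p i z * a p tau r z (tau i z))) /\
    (\forall t \near +oo,
       integrable_on (h tau t) t
         (fun z => \sum_(i < m.+1) p i z * a p tau r (h tau z) (tau i z))).

Definition tau_inv tau t : R := sup [set s | 0 <= s /\ tau_min tau s <= t].

(* x is differentiable at t relative to A, with derivative d; at an end point
   of an interval A, the derivative is thus one-sided. *)
Definition has_deriv_within (A : set R) x t (d : R) : Prop :=
  (x z - x t) / (z - t) @[z --> within A t^'] --> d.

Definition solution_from p tau (T0 : R) x : Prop :=
  {within `[T0, +oo[, continuous x} /\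
  exists dx : R -> R,
    {within `[tau_inv tau T0, +oo[, continuous dx} /\
    forall t, tau_inv tau T0 <= t ->
      has_deriv_within `[tau_inv tau T0, +oo[ x t (dx t) /\
      dx t + \sum_(i < m.+1) p i t * x (tau i t) = 0.

Definition solution p tau x : Prop :=
  exists T0 : R, 0 <= T0 /\ solution_from p tau T0 x.

Definition oscillatory x : Prop :=
  ~ (\forall t \near +oo, 0 < x t) /\ ~ (\forall t \near +oo, x t < 0).

Definition liminf_pinfty (f : R -> R) : \bar R :=
  limf_einf (EFin \o f) (pinfty_nbhs R).

Definition limsup_pinfty (f : R -> R) : \bar R :=
  limf_esup (EFin \o f) (pinfty_nbhs R).

End DelayEquation.

(* Main.v *)
Require Import Defs.
From mathcomp Require Import all_boot all_order all_algebra.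
From mathcomp Require Import all_classical all_reals all_analysis.
From mathcomp Require Import measurable_realfun ring.
Import Order.TTheory GRing.Theory Num.Theory.
Import numFieldNormedType.Exports.
Local Open Scope classical_set_scope.
Local Open Scope ring_scope.
Set Implicit Arguments.
Unset Strict Implicit.
Unset Printing Implicit Defensive.

(* If x is an eventually positive solution, then -x'/x is the sum of the
   p_i(t) x(tau_i(t)) / x(t), and a Gronwall argument gives inductively
   a_r(t,s) x(t) <= x(s). The same argument, with the lower bound alpha on the
   integrals of the p_i, turns an eventual bound x(h(t)) >= c x(t) into
   x(h(t)) >= exp(c alpha') x(t) for alpha' < alpha, so every l < lambda0 is an
   eventual lower bound of x(h(t)) / x(t). For 1 < l < lambda0, pick u in
   [h(t),t] with x(u) = x(h(t)) / l: dividing the equation by x on [h(t),u]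
   bounds the limsup integral there by (ln l) / l, and integrating it on [u,t]
   bounds it by 1 / l. Let l tend to lambda0. *)

(** * Integrals with respect to the completed Lebesgue measure *)

Section CompletedIntegral.
Context {R : realType}.
Notation mu := (@completed_lebesgue_measure R).
Notation caraR := (caratheodory_type (@wlength R idfun)^*%mu).

(* The completed measure is pushed forward to the Borel sigma-algebra, on which
   the fundamental theorem of calculus is available, along the identity. *)
Let idR : caraR -> measurableTypeR R := fun z => z.

Let measurable_idR : measurable_fun [set: caraR] idR.
Proof. by move=> _ B mB; rewrite setTI; exact: sub_caratheodory. Qed.

Lemma measurable_completed (D : set R) :
  measurable (D : set (measurableTypeR R)) -> measurable (D : set caraR).
Proof. exact: sub_caratheodory. Qed.

Lemma measurable_fun_completed (D : set R) (f : R -> R) :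
  measurable (D : set (measurableTypeR R)) ->
  measurable_fun (D : set (measurableTypeR R)) f ->
  measurable_fun (D : set caraR) f.
Proof.
by move=> mD mf _ B mB; apply: sub_caratheodory; exact: mf.
Qed.

Lemma ge0_integral_completed (D : set R) (f : R -> R) :
  measurable (D : set (measurableTypeR R)) ->
  measurable_fun (D : set (measurableTypeR R)) f ->
  (forall z, D z -> 0 <= f z) ->
  (\int[mu]_(z in D) (f z)%:E = \int[lebesgue_measure]_(z in D) (f z)%:E)%E.
Proof.
move=> mD mf f0.
transitivity (\int[pushforward mu idR]_(z in D) (f z)%:E)%E; last first.
  by apply: eq_measure_integral.
rewrite (ge0_integral_pushforward measurable_idR)//.
- exact/measurable_EFinP.
- by move=> z; rewrite inE => /f0; rewrite lee_fin.
Qed.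

(** Since [f] is only integrable, it is compared with a continuous [g], to which the fundamental
    theorem of calculus applies. Integrability of [f] supplies the finiteness needed to return from
    extended to real integrals. *)
Lemma le_integral_increment (a b : R) (f g G : R -> R) : a <= b ->
  (forall z, a <= z <= b -> is_derive z 1 G (g z)) ->
  (forall z, a <= z <= b -> {for z, continuous g}) ->
  integrable_on a b f ->
  (forall z, a <= z <= b -> 0 <= f z <= g z) ->
  \int[mu]_(z in `[a, b]) f z <= G b - G a.
Proof.
move=> ab dG cg intf fg.
have itv z : `[a, b]%classic z -> a <= z <= b by rewrite /= in_itv.
have mD : measurable (`[a, b]%classic : set (measurableTypeR R)) by [].
have cgw : {within `[a, b], continuous g}.
  by apply: continuous_in_subspaceT => z /set_mem /itv; exact: cg.
have mg : measurable_fun (`[a, b]%classic : set (measurableTypeR R)) g.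
  exact: subspace_continuous_measurable_fun.
have cG z : a <= z <= b -> {for z, continuous G}.
  move=> /dG ?; apply: differentiable_continuous.
  exact/derivable1_diffP.
have intg : (\int[mu]_(z in `[a, b]) (g z)%:E = (G b - G a)%:E)%E.
  rewrite ge0_integral_completed//; last first.
    by move=> z /itv/fg/andP[/le_trans]; apply.
  (* The fundamental theorem requires [a < b], so the one-point interval is treated apart. *)
  move: ab; rewrite le_eqVlt => /predU1P[ab|ab].
    by rewrite -ab set_itv1 integral_set1 subrr.
  rewrite (@continuous_FTC2 _ g G)// ?EFinB//.
  - split.
    + by move=> z; rewrite in_itv/= => /andP[/ltW az /ltW zb];
        have := dG z; rewrite az zb => /(_ isT) [].
    + by apply: cvg_at_right_filter; apply: cG; rewrite lexx ltW.
    + by apply: cvg_at_left_filter; apply: cG; rewrite lexx ltW.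
  - move=> z; rewrite in_itv/= => /andP[/ltW az /ltW zb].
    have := dG z; rewrite az zb => /(_ isT) dGz.
    by rewrite derive1E derive_val.
have fin : (\int[mu]_(z in `[a, b]) (f z)%:E <= (G b - G a)%:E)%E.
  rewrite -intg; apply: ge0_le_integral.
  - exact: measurable_completed.
  - by move=> z /itv/fg/andP[]; rewrite lee_fin.
  - exact: (measurable_int mu).
  - apply/measurable_EFinP; exact: measurable_fun_completed.
  - by move=> z /itv/fg/andP[_]; rewrite lee_fin.
rewrite /Rintegral -lee_fin fineK//.
by apply: integrable_fin_num intf; exact: measurable_completed.
Qed.

(** The interval splits into [[a, b]] and []b, c]]; enlarging the second piece to [[b, c]] can only
    increase the integral of a nonnegative function. *)
Lemma le_integral_split (a b c : R) (f : R -> R) : a <= b <= c ->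
  integrable_on a c f -> (forall z, a <= z <= c -> 0 <= f z) ->
  \int[mu]_(z in `[a, c]) f z <=
    \int[mu]_(z in `[a, b]) f z + \int[mu]_(z in `[b, c]) f z.
Proof.
move=> /andP[ab bc] intf f0.
have m0 (i : interval R) : measurable ([set` i] : set caraR).
  exact: measurable_completed.
have mW (i : interval R) : [set` i] `<=` `[a, c]%classic ->
    mu.-integrable [set` i] (EFin \o f).
  by move=> ic; apply: integrableS intf.
have E : `[a, c]%classic = `[a, b] `|` `]b, c] :> set R.
  apply: itv_bndbnd_setU; by rewrite bnd_simp.
rewrite E Rintegral_setU//; first last.
- apply/disj_setPS => z [] /=; rewrite !in_itv/= => /andP[_ zb] /andP[bz _].
  by move: (lt_le_trans bz zb); rewrite ltxx.
- by rewrite -E.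
rewrite lerD2l.
rewrite /Rintegral fine_le//.
- apply: integrable_fin_num => //; apply: mW => z /=.
  by rewrite !in_itv/= => /andP[/ltW bz ->]; rewrite (le_trans ab bz).
- apply: integrable_fin_num => //; apply: mW => z /=.
  by rewrite !in_itv/= => /andP[bz ->]; rewrite (le_trans ab bz).
apply: ge0_subset_integral => //.
- apply: (measurable_int mu); apply: mW => z /=.
  by rewrite !in_itv/= => /andP[bz ->]; rewrite (le_trans ab bz).
- move=> z /=; rewrite in_itv/= lee_fin => /andP[bz zc].
  by apply: f0; rewrite zc (le_trans ab bz).
- by move=> z /=; rewrite !in_itv/= => /andP[/ltW -> ->].
Qed.

Lemma integrable_on_sub (a b c d : R) (f : R -> R) :
  a <= c -> d <= b -> integrable_on a b f -> integrable_on c d f.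
Proof.
move=> ac db; apply: integrableS; [exact: measurable_completed..|].
move=> z /=; rewrite !in_itv/= => /andP[cz zd].
by rewrite (le_trans ac cz) (le_trans zd db).
Qed.

End CompletedIntegral.

(** * Thresholds near infinity, and monotonicity of [h] *)

Lemma near_pinfty_ge {R : realType} (P : R -> Prop) (M : R) :
  (\forall t \near +oo, P t) -> exists2 N, M <= N & forall t, N <= t -> P t.
Proof.
move=> [N [_ NP]]; exists (Num.max M (N + 1)); first by rewrite le_max lexx.
move=> t; rewrite ge_max => /andP[_ Nt]; apply: NP.
by apply: lt_le_trans Nt; rewrite ltrDl.
Qed.

Section Delays.
Context {R : realType} {m : nat} (tau : 'I_m.+1 -> R -> R).
Context (tau_lt : forall i t, 0 <= t -> tau i t < t).

Lemma tau_ge (M N : R) : (forall i, tau i t @[t --> +oo] --> +oo) ->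
  exists2 S, N <= S & forall t i, S <= t -> M <= tau i t.
Proof.
move=> tau_cvg.
have /(@near_pinfty_ge _ _ N)[S NS SP] :
    \forall t \near +oo, forall i, M <= tau i t.
  have := @filter_forall R 'I_m.+1 (fun i t => M <= tau i t) +oo _.
  apply=> i; have /cvgryPge := tau_cvg i; exact.
by exists S => // t i /SP.
Qed.

Let tau_image_le i t s : 0 <= t -> [set tau i s | s in `[0, t]] s -> s <= t.
Proof.
move=> t0 [z /=]; rewrite in_itv/= => /andP[z0 zt] <-.
by rewrite ltW// (lt_le_trans (tau_lt i z0)).
Qed.

Let tau_image_sup i t : 0 <= t -> has_sup [set tau i s | s in `[0, t]].
Proof.
move=> t0; split; last by exists t => z; exact: tau_image_le.
by exists (tau i 0), 0 => //=; rewrite in_itv/= lexx.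
Qed.

Lemma tau_le_h i s t : 0 <= s <= t -> tau i s <= h tau t.
Proof.
move=> /andP[s0 st]; have t0 := le_trans s0 st.
rewrite /h; apply: le_trans (le_bigmax _ (fun i => h_ tau i t) i).
apply: ub_le_sup; first by have [] := tau_image_sup i t0.
by exists s => //=; rewrite in_itv/= s0.
Qed.

Lemma h_le t : 0 <= t -> h tau t <= t.
Proof.
move=> t0; have hi i : h_ tau i t <= t.
  apply: ge_sup; first by have [] := tau_image_sup i t0.
  by move=> z; exact: tau_image_le.
exact: bigmax_le.
Qed.

Lemma lt_h_exists t d : 0 <= t -> d < h tau t ->
  exists s i, 0 <= s <= t /\ d < tau i s.
Proof.
move=> t0 dh; have [i di] : exists i, d < h_ tau i t.
  apply: contrapT => /forallNP nd; move: dh; rewrite ltNge => /negP; apply.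
  by apply: bigmax_le => [|i _]; rewrite leNgt; exact/negP/nd.
have [z [s /=]] := sup_gt (proj1 (tau_image_sup i t0)) di.
by rewrite in_itv/= => s0t <- ds; exists s, i.
Qed.

Lemma h_homo s t : 0 <= s -> s <= t -> h tau s <= h tau t.
Proof.
move=> s0 st; rewrite leNgt; apply/negP => /(lt_h_exists s0).
move=> [z [i [/andP[z0 zs]]]].
by apply/negP; rewrite -leNgt tau_le_h// z0 (le_trans zs).
Qed.

Lemma tau_le_max i t : tau i t <= tau_max tau t.
Proof. exact: (le_bigmax _ (fun i => tau i t) i). Qed.

Lemma tau_max_lt t : 0 <= t -> tau_max tau t < t.
Proof. by move=> t0; apply: bigmax_lt => // *; exact: tau_lt. Qed.

End Delays.

(** * Gronwall estimates along an eventually positive solution *)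

Section PositiveSolution.
Context {R : realType} {m : nat} (p tau : 'I_m.+1 -> R -> R).
Context (p_ge0 : forall i t, 0 <= t -> 0 <= p i t).
Context (tau_lt : forall i t, 0 <= t -> tau i t < t).
Context (tau_cvg : forall i, tau i t @[t --> +oo] --> +oo).
Context (int_ok : integrals_meaningful p tau).
Context (x dx : R -> R) (T : R).
Context (T_ge0 : 0 <= T).
Context (x_gt0 : forall t, T <= t -> 0 < x t).
Context (x_tau_gt0 : forall t i, T <= t -> 0 < x (tau i t)).
Context (dxE : forall t, T <= t -> is_derive t 1 x (dx t)).
Context (dx_cont : forall t, T <= t -> {for t, continuous dx}).
Context (eqn : forall t, T <= t -> - dx t = \sum_i p i t * x (tau i t)).
Notation mu := (@completed_lebesgue_measure R).

Let x_cont t : T <= t -> {for t, continuous x}.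
Proof.
by move=> /dxE ?; apply: differentiable_continuous; exact/derivable1_diffP.
Qed.

(** The hypothesis says [f <= - dx / x], and the right-hand side is the derivative of [- ln x]. *)
Lemma integral_le_ln (s t : R) (f : R -> R) : T <= s -> s <= t ->
  integrable_on s t f ->
  (forall z, s <= z <= t -> 0 <= f z /\ f z * x z <= - dx z) ->
  \int[mu]_(z in `[s, t]) f z <= ln (x s) - ln (x t).
Proof.
move=> Ts st intf fdx.
have Tz z : s <= z <= t -> T <= z by move=> /andP[sz _]; exact: le_trans sz.
have -> : ln (x s) - ln (x t) = - ln (x t) - - ln (x s) by rewrite opprK addrC.
apply: (@le_integral_increment _ _ _ _ (fun z => - dx z / x z)
         (fun z => - ln (x z))) => // z /[dup] /Tz Tz' stz.
- have xz := x_gt0 Tz'; have := is_derive1_ln xz => dln.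
  have dxz := dxE Tz'.
  rewrite mulNr; apply: is_deriveN.
  by have := is_derive1_comp dln dxz; rewrite mulrC.
- have xz := x_gt0 Tz'.
  apply: cvgM; first by apply: cvgN; exact: dx_cont.
  by apply: cvgV; [exact: lt0r_neq0|exact: x_cont].
- have [f0 fz] := fdx z stz.
  by rewrite f0 ler_pdivlMr ?x_gt0.
Qed.

Lemma x_nonincr (s t : R) : T <= s -> s <= t -> x t <= x s.
Proof.
move=> Ts st.
(* With [f = 0] the logarithmic estimate reads [0 <= ln (x s) - ln (x t)]. *)
have := @integral_le_ln s t (fun=> 0) Ts st.
rewrite Rintegral_cst ?mul0r; last exact: measurable_completed.
have xs := x_gt0 Ts; have xt := x_gt0 (le_trans Ts st).
rewrite subr_ge0 ler_ln//; apply.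
  by apply: integrable0.
move=> z /andP[sz _]; rewrite lexx mul0r eqn ?(le_trans Ts)//; split => //.
apply: sumr_ge0 => i _; have Tz := le_trans Ts sz.
apply: mulr_ge0; last exact/ltW/x_tau_gt0.
by apply: p_ge0; exact: le_trans Tz.
Qed.

Lemma a_ge0 r t s : 0 <= a p tau r t s.
Proof. by case: r => [|r] /=; [exact: ler01|exact: expR_ge0]. Qed.

(** Induction on [r]: the bound from [tau i z] to [z] makes the integrand of the next iterate, times
    [x z], at most [- dx z], and [integral_le_ln] applies. The threshold grows with [r] because
    every [tau i z] must lie beyond the previous one. *)
Lemma a_mul_le r : exists2 S, T <= S &
  forall s t, S <= s -> s <= t -> a p tau r t s * x t <= x s.
Proof.
elim: r => [|r [S TS IH]].
  by exists T => // s t Ts st; rewrite mul1r x_nonincr.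
have [N SN intN] := near_pinfty_ge S (int_ok r).1.
have [S' NS' tauS'] := tau_ge S N tau_cvg.
exists S'; first exact/(le_trans TS)/(le_trans SN).
move=> s t S's st.
have Ts : T <= s by rewrite (le_trans TS) ?(le_trans SN) ?(le_trans NS').
have xs := x_gt0 Ts; have xt := x_gt0 (le_trans Ts st).
rewrite -ler_pdivlMr//= -[leRHS]lnK ?posrE ?divr_gt0// ler_expR.
rewrite ln_div ?posrE//; apply: integral_le_ln => //.
  by apply: intN => //; exact: le_trans S's.
move=> z /andP[sz zt].
have Tz := le_trans Ts sz; have z0 := le_trans T_ge0 Tz; split.
  by apply: sumr_ge0 => i _; rewrite mulr_ge0 ?p_ge0 ?a_ge0.
rewrite eqn// mulr_suml; apply: ler_sum => i _.
rewrite -mulrA ler_wpM2l ?p_ge0//; apply: IH.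
  by apply: tauS'; exact: le_trans sz.
exact/ltW/tau_lt.
Qed.

(** As [tau j z <= h tau z] and [x] is nonincreasing, the ratio bound gives
    [- dx z >= c * (\sum_j p j z) * x z]. Integrating over [[tau_max tau s, s]] yields the factor
    [expR (c * b)]. *)
Lemma ratio_step (c b S : R) : 0 <= c ->
  (forall t, S <= t ->
     b <= \int[mu]_(s in `[tau_max tau t, t]) \sum_i p i s) ->
  (forall t, S <= t -> c * x t <= x (h tau t)) ->
  exists S', forall t, S' <= t -> expR (c * b) * x t <= x (h tau t).
Proof.
move=> c0 bS cS.
(* Since [a] at index 0 is 1, this instance is integrability of the sum of the [p i] itself. *)
have [N TN intN] := near_pinfty_ge (Num.max T S) (int_ok 0%N).1.
move: TN; rewrite ge_max => /andP[TN SN].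
have [S1 NS1 tauS1] := tau_ge T N tau_cvg.
have [S2 S12 tauS2] := tau_ge S1 S1 tau_cvg.
(* The slack [+ 1] makes [S2 < h tau t] strict, so points just left of [h tau t] still lie beyond
   [S2]. *)
have [S3 S23 tauS3] := tau_ge (S2 + 1) S2 tau_cvg.
have TS1 := le_trans TN NS1; have TS2 := le_trans TS1 S12.
exists S3 => t S3t.
have TS3 := le_trans TS2 S23; have Tt := le_trans TS3 S3t.
have t0 := le_trans T_ge0 Tt.
have S2h : S2 < h tau t.
  apply: lt_le_trans (tau_le_h tau_lt ord0 (_ : 0 <= t <= t)); last first.
    by rewrite t0 lexx.
  by apply: lt_le_trans (tauS3 t ord0 S3t); rewrite ltrDl.
have Th := le_trans TS2 (ltW S2h).
(* The supremum defining h t need not be attained, so the bound is proved at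
   the points d < h t and passes to the limit by continuity of x. Any s with
   d < tau i s satisfies S2 < s, so the bound on [tau_max s, s] applies. *)
have step d : S2 < d -> d < h tau t -> expR (c * b) * x t <= x d.
  move=> S2d dh.
  have [s [i [/andP[s0 st] ds]]] := lt_h_exists tau_lt t0 dh.
  have S2s : S2 <= s by rewrite ltW// (lt_trans S2d)// (lt_trans ds)// tau_lt.
  have dM : d < tau_max tau s by apply: lt_le_trans ds _; exact: tau_le_max.
  have S1M : S1 <= tau_max tau s.
    by apply: le_trans (tau_le_max _ ord0 _); exact: tauS2.
  have TM := le_trans TS1 S1M.
  have Td := le_trans TS2 (ltW S2d).
  have Ts := le_trans TS2 S2s.
  have Ms := ltW (tau_max_lt tau_lt s0).
  have intP : integrable_on (tau_max tau s) s (fun z => \sum_i p i z).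
    have := intN (tau_max tau s) (le_trans NS1 S1M) s Ms.
    by rewrite /=; under eq_fun do under eq_bigr do rewrite mulr1.
  have : c * \int[mu]_(z in `[tau_max tau s, s]) \sum_i p i z <=
      ln (x (tau_max tau s)) - ln (x s).
    rewrite -RintegralZl//; last exact: measurable_completed.
    apply: integral_le_ln => //.
      by apply: (integrableZl _ c intP); exact: measurable_completed.
    move=> z /andP[Mz zs]; have S1z := le_trans S1M Mz.
    have Tz := le_trans TS1 S1z; have z0 := le_trans T_ge0 Tz; split.
      by rewrite mulr_ge0// sumr_ge0// => j _; exact: p_ge0.
    rewrite eqn// -mulrA mulrCA mulr_suml; apply: ler_sum => j _.
    rewrite ler_wpM2l ?p_ge0//.
    apply: le_trans (cS _ (le_trans SN (le_trans NS1 S1z))) _.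
    by apply: x_nonincr; [exact: tauS1|apply: tau_le_h => //; rewrite z0 lexx].
  have := bS s (le_trans SN (le_trans NS1 (le_trans S12 S2s))).
  move=> /(ler_wpM2l c0) /le_trans /[apply].
  have xs := x_gt0 Ts; have xM := x_gt0 TM.
  rewrite -ln_div ?posrE// -(ler_expR (c * b)) lnK ?posrE ?divr_gt0//.
  rewrite ler_pdivlMr// => H.
  (* Monotonicity of [x] carries the bound from [tau_max tau s] down to [d] and from [s] up to
     [t]. *)
  apply: le_trans (x_nonincr Td (ltW dM)); apply: le_trans H.
  by rewrite ler_wpM2l ?expR_ge0// x_nonincr.
rewrite leNgt; apply/negP => xK.
have /cvgr_lt /(_ _ xK) : x d @[d --> (h tau t)^'-] --> x (h tau t).
  by apply: cvg_at_left_filter; exact: x_cont.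
move=> near_lt; near (h tau t)^'- => d.
have : x d < expR (c * b) * x t by near: d; exact: near_lt.
apply/negP; rewrite -leNgt; apply: step; near: d.
  exact: nbhs_left_gt.
exact: nbhs_left_lt.
Unshelve. all: by end_near. Qed.

(** * The ratio [x (h t) / x t] and the root [lambda0] *)

Context (alpha lambda0 : R).
Context (alpha_gt0 : 0 < alpha).
Context (liminf_ge : forall b, b < alpha -> exists S, forall t, S <= t ->
  b <= \int[mu]_(s in `[tau_max tau t, t]) \sum_i p i s).
Context (lambda0_root : lambda0 = expR (alpha * lambda0)).
Context (lambda0_min : forall l : R, l = expR (alpha * l) -> lambda0 <= l).

Lemma lambda0_gt1 : 1 < lambda0.
Proof.
by rewrite lambda0_root expR_gt1 mulr_gt0// lambda0_root expR_gt0.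
Qed.

(** The function [expR (alpha * y) - y] equals 1 at 0; were it nonpositive at [l], the intermediate
    value theorem would give a root at most [l], hence below the smallest one. *)
Lemma lt_expR_of_lt_root l : 0 <= l -> l < lambda0 -> l < expR (alpha * l).
Proof.
move=> l0 ll0; rewrite ltNge; apply/negP => el.
pose g y := expR (alpha * y) - y.
have cg : {within `[0, l], continuous g}.
  apply: continuous_subspaceT => y.
  apply: cvgB; last exact: cvg_id.
  apply: continuous_comp; last exact: continuous_expR.
  by apply: cvgM; [exact: cvg_cst|exact: cvg_id].
have [|y] := @IVT _ g 0 l 0 l0 cg.
  rewrite ge_min le_max /g mulr0 expR0 subr0 ler01 /= andbT.
  by rewrite subr_le0 el orbT.
rewrite in_itv/= => /andP[_ yl] /eqP; rewrite subr_eq0.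
move=> /eqP /esym/lambda0_min.
by rewrite leNgt (le_lt_trans yl).
Qed.

Lemma ratio_lt_lambda0 c : c < lambda0 ->
  exists S, forall t, S <= t -> c * x t <= x (h tau t).
Proof.
(* If [c] fails, it bounds from above the downward closed set [A] of eventual lower bounds, so
   [sup A] is a genuine supremum below [lambda0]. *)
move=> cl0; apply: contrapT => nc.
pose A := [set l | exists S, forall t, S <= t -> l * x t <= x (h tau t)].
have A1 : A 1.
  have [S TS tauS] := tau_ge T T tau_cvg.
  exists S => t St; have t0 := le_trans T_ge0 (le_trans TS St).
  rewrite mul1r x_nonincr ?h_le//.
  by apply: le_trans (tauS t ord0 St) _; rewrite tau_le_h// t0 lexx.
have Adown l l' : l' <= l -> A l -> A l'.
  move=> l'l [S AS]; exists (Num.max T S) => t.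
  rewrite ge_max => /andP[Tt St]; apply: le_trans (AS t St).
  by rewrite ler_wpM2r// ltW// x_gt0.
have ubA : ubound A c.
  move=> l Al; rewrite leNgt; apply/negP => cl; apply: nc.
  exact: Adown (ltW cl) Al.
have supA : has_sup A by split; [exists 1|exists c].
pose L := sup A.
have L1 : 1 <= L by apply: ub_le_sup => //; exists c.
have Ll0 : L < lambda0.
  by apply: le_lt_trans cl0; apply: ge_sup => //; exists 1.
(* The supremum L of the eventual lower bounds cannot be below lambda0: the step
   from slightly smaller c and b would produce an element of A above L. *)
have LE := lt_expR_of_lt_root (le_trans ler01 L1) Ll0.
(* [F e] is the constant that [ratio_step] produces from [L - e] and [alpha - e]; it tends to
   [expR (alpha * L) > L]. *)
pose F e := expR ((L - e) * (alpha - e)).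
have cF : F e @[e --> (0:R)^'+] --> expR (alpha * L).
  have -> : expR (alpha * L) = F 0 by rewrite /F !subr0 mulrC.
  apply: cvg_at_right_filter.
  apply: (@continuous_comp _ _ _ (fun e => (L - e) * (alpha - e)) expR);
    last exact: continuous_expR.
  by apply: cvgM; apply: cvgB; (exact: cvg_cst || exact: cvg_id).
near (0:R)^'+ => e.
have e0 : 0 < e by near: e; exact: nbhs_right_gt.
(* Together with [1 <= L] this keeps [L - e] nonnegative, as [ratio_step] requires. *)
have e1 : e < 1 by near: e; exact: nbhs_right_lt.
have LF : L < F e by near: e; exact: (cvgr_gt _ cF).
have ALe : A (L - e).
  have [l Al Lel] := sup_adherent e0 supA.
  exact: Adown (ltW Lel) Al.
have [S1 S1b] : exists S, forall t, S <= t ->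
    alpha - e <= \int[mu]_(s in `[tau_max tau t, t]) \sum_i p i s.
  by apply: liminf_ge; rewrite ltrBlDr ltrDl.
have [S2 S2c] := ALe.
have : A (F e).
  apply: (@ratio_step _ _ (Num.max S1 S2)).
  - by rewrite subr_ge0 (le_trans (ltW e1)).
  - by move=> t; rewrite ge_max => /andP[? _]; exact: S1b.
  - by move=> t; rewrite ge_max => /andP[_ ?]; exact: S2c.
move=> AF; have : F e <= L by apply: ub_le_sup => //; exists c.
by rewrite leNgt LF.
Unshelve. all: by end_near. Qed.

Lemma limsup_integral_le r l : 1 < l -> l < lambda0 ->
  \forall t \near +oo,
    \int[mu]_(z in `[h tau t, t])
      \sum_i p i z * a p tau r (h tau z) (tau i z) <= (1 + ln l) / l.
Proof.
move=> l1 ll0.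
have l0 : 0 < l by apply: lt_trans l1.
have [S0 lS0] := ratio_lt_lambda0 ll0.
have [Sa TSa aSa] := a_mul_le r.
have [S1 S01 intS1] := near_pinfty_ge (Num.max Sa S0) (int_ok r).2.
move: S01; rewrite ge_max => /andP[Sa1 S01].
have TS1 := le_trans TSa Sa1.
have [S2 S12 tauS2] := tau_ge S1 S1 tau_cvg.
have [S3 S23 tauS3] := tau_ge S2 S2 tau_cvg.
have TS2 := le_trans TS1 S12.
exists S3; split; [exact: num_real|move=> t /ltW S3t].
have t0 : 0 <= t by rewrite (le_trans T_ge0)// (le_trans TS2)// (le_trans S23).
have intf := intS1 t (le_trans S12 (le_trans S23 S3t)).
set f := (fun z => _) in intf.
change (\int[mu]_(z in `[h tau t, t]) f z <= (1 + ln l) / l).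
have S2h : S2 <= h tau t.
  by apply: le_trans (tauS3 t ord0 S3t) _; rewrite tau_le_h// t0 lexx.
have Th := le_trans TS2 S2h; have ht := h_le tau_lt t0.
have Tt := le_trans Th ht.
set X := x (h tau t); have X0 : 0 < X by exact: x_gt0.
have lxt : x t <= X / l.
  rewrite ler_pdivlMr// mulrC lS0//.
  by rewrite (le_trans S01)// (le_trans S12)// (le_trans S23).
(* The ratio bound at [t] and [1 < l] place [X / l] between [x t] and [X]. *)
have [||u] := @IVT _ x (h tau t) t (X / l) ht.
- apply: continuous_in_subspaceT => z /set_mem /=.
  by rewrite in_itv/= => /andP[hz _]; apply: x_cont; exact: le_trans hz.
- rewrite ge_min lxt orbT le_max -/X /=.
  by apply/orP; left; rewrite ler_pdivrMr// ler_peMr// ltW.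
rewrite in_itv/= => /andP[hu ut] xu.
(* The third fact is [a_mul_le] from [tau i z] to [h tau z], summed in the equation. The fourth
   follows because [h tau z <= h tau t] gives [X <= x (h tau z)]. *)
have f_facts z : h tau t <= z -> z <= t ->
    [/\ T <= z, 0 <= f z, f z * x (h tau z) <= - dx z & f z * X <= - dx z].
  move=> hz zt; have S2z := le_trans S2h hz.
  have Tz := le_trans TS2 S2z; have z0 := le_trans T_ge0 Tz.
  have fz0 : 0 <= f z.
    by apply: sumr_ge0 => i _; rewrite mulr_ge0 ?p_ge0 ?a_ge0.
  have fdx : f z * x (h tau z) <= - dx z.
    rewrite eqn// mulr_suml; apply: ler_sum => i _.
    rewrite -mulrA ler_wpM2l ?p_ge0//; apply: aSa.
      by apply: le_trans Sa1 _; exact: tauS2.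
    by rewrite tau_le_h// z0 lexx.
  split => //; apply: le_trans fdx; rewrite ler_wpM2l//; apply: x_nonincr.
    apply: le_trans TS1 _; apply: le_trans (tauS2 z ord0 S2z) _.
    by rewrite tau_le_h// z0 lexx.
  exact: h_homo.
(* Here [l * x z <= x (h tau z)] gives [l * f z * x z <= - dx z], and the logarithmic estimate ends
   in [ln (X / x u) = ln l]. *)
have part1 : l * \int[mu]_(z in `[h tau t, u]) f z <= ln l.
  have intf1 : integrable_on (h tau t) u f by exact: integrable_on_sub intf.
  rewrite -RintegralZl//; last exact: measurable_completed.
  have -> : ln l = ln (x (h tau t)) - ln (x u).
    rewrite xu -/X ln_div ?posrE//; ring.
  apply: integral_le_ln => //.
    by apply: (integrableZl _ l intf1); exact: measurable_completed.
  move=> z /andP[hz zu].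
  have [Tz fz0 fdx _] := f_facts z hz (le_trans zu ut).
  split; first by rewrite mulr_ge0// ltW.
  apply: le_trans fdx; rewrite -mulrA mulrCA ler_wpM2l//.
  by apply: lS0; rewrite (le_trans S01)// (le_trans S12)// (le_trans S2h).
(* Here [f <= - dx / X] with the constant [X]; the antiderivative [- x / X] grows by
   [(x u - x t) / X], at most [x u / X = l^-1]. *)
have part2 : \int[mu]_(z in `[u, t]) f z <= l^-1.
  have intf2 : integrable_on u t f by exact: integrable_on_sub intf.
  apply: (@le_trans _ _ (- x t / X - - x u / X)); last first.
    rewrite !mulNr opprK xu addrC mulrAC divff ?gt_eqF// mul1r gerBl.
    by rewrite divr_ge0// ltW// x_gt0.
  apply: (@le_integral_increment _ _ _ _ (fun z => - dx z / X)
            (fun z => - x z / X)) => // z /andP[uz zt].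
  - have [Tz _ _ _] := f_facts z (le_trans hu uz) zt.
    have dxz := dxE Tz.
    by apply: is_derive_eq; rewrite scaler0 add0r [RHS]mulrC.
  - have [Tz _ _ _] := f_facts z (le_trans hu uz) zt.
    by apply: cvgM; [apply: cvgN; exact: dx_cont|exact: cvg_cst].
  - have [_ -> _ fX] := f_facts z (le_trans hu uz) zt.
    by rewrite ler_pdivlMr.
have hut : h tau t <= u <= t by rewrite hu ut.
apply: le_trans (le_integral_split hut intf _) _.
  by move=> z /andP[hz zt]; have [] := f_facts z hz zt.
rewrite mulrDl mul1r addrC lerD// ler_pdivlMr// mulrC; exact: part1.
Qed.

End PositiveSolution.

(** * One-sided derivatives, lower and upper limits *)

Section Limits.
Context {R : realType}.

(** Near an interior point of [A] the restriction to [A] excludes nothing, so the limit is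
    two-sided; the shift [z = h + t] matches the library's difference quotient. *)
Lemma is_derive_of_within (A : set R) (x : R -> R) (t d : R) :
  nbhs t A -> has_deriv_within A x t d -> is_derive t 1 x d.
Proof.
move=> tA xd.
have lim : h^-1 *: (x (h *: (1:R) + t) - x t) @[h --> 0^'] --> d.
  have E : (fun h : R => h^-1 *: (x (h *: (1:R) + t) - x t)) =
      (fun z => (x z - x t) / (z - t)) \o (fun h => h + t).
    by apply/funext => h /=; rewrite addrK mulrC [h *: _]mulr1.
  rewrite E; apply: (@cvg_comp _ _ _ (fun h => h + t) _ _ (within A t^')) xd.
  move=> B; rewrite /within/= => tB.
  have shift_cvg : h + t @[h --> (0:R)] --> t.
    rewrite -[X in _ --> X]add0r.
    by apply: cvgD; [exact: cvg_id|exact: cvg_cst].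
  have H : \forall h \near (0:R),
      A (h + t) /\ (h + t != t -> A (h + t) -> B (h + t)).
    exact: (shift_cvg _ (filterI tA tB)).
  change (\forall h \near (0:R)^', B (h + t)).
  near=> h.
  have [Ah Bh] : A (h + t) /\ (h + t != t -> A (h + t) -> B (h + t)).
    by near: h; exact: nbhs_dnbhs H.
  apply: Bh => //; rewrite -subr_eq0 addrK.
  by near: h; exact: nbhs_dnbhs_neq.
apply: DeriveDef; first by apply/cvg_ex; exists d.
exact: cvg_lim lim.
Unshelve. all: by end_near. Qed.

Lemma near_ge_of_lt_liminf (f : R -> R) (l b : R) :
  liminf_pinfty f = l%:E -> b < l -> \forall t \near +oo, b <= f t.
Proof.
rewrite /liminf_pinfty limf_einfE => fl bl.
have : (b%:E < ereal_sup [set ereal_inf [set (EFin \o f) y | y in V] |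
    V in pinfty_nbhs R])%E by rewrite fl lte_fin.
move=> /ereal_sup_gt[_ [V FV <-]] bV.
apply: filterS FV => t Vt; rewrite -lee_fin; apply: le_trans (ltW bV) _.
by apply: ereal_inf_lbound; exists t.
Qed.

Lemma limsup_le_of_near (f : R -> R) (b : R) :
  (\forall t \near +oo, f t <= b) -> (limsup_pinfty f <= b%:E)%E.
Proof.
move=> fb; rewrite /limsup_pinfty limf_esupE.
apply: ge_ereal_inf.
exists (ereal_sup [set (EFin \o f) y | y in [set t | f t <= b]]).
  by exists [set t | f t <= b].
by apply: ge_ereal_sup => _ [t ft <-]; rewrite lee_fin.
Qed.

End Limits.

(** * Oscillation of all solutions *)

Theorem theorem2 (R : realType) (m : nat) (p tau : 'I_m.+1 -> R -> R)
    (p_ge0 : forall (i : 'I_m.+1) (t : R), 0 <= t -> 0 <= p i t)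
    (tau_lt : forall (i : 'I_m.+1) (t : R), 0 <= t -> tau i t < t)
    (tau_cvg : forall i, tau i t @[t --> +oo] --> +oo)
    (int_ok : integrals_meaningful p tau)
    (alpha lambda0 : R)
    (alphaE : liminf_pinfty (fun t : R =>
       \int[completed_lebesgue_measure]_(s in `[tau_max tau t, t])
         \sum_(i < m.+1) p i s) = alpha%:E)
    (alpha_gt0 : 0 < alpha)
    (alpha_le : alpha <= (expR 1)^-1)
    (lambda0_root : lambda0 = expR (alpha * lambda0))
    (lambda0_min : forall l : R, l = expR (alpha * l) -> lambda0 <= l)
    (r : nat) (r_gt0 : (0 < r)%N)
    (limsup_gt : (((1 + ln lambda0) / lambda0)%:E <
       limsup_pinfty (fun t : R =>
         \int[completed_lebesgue_measure]_(z in `[h tau t, t])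
           \sum_(i < m.+1) p i z * a p tau r (h tau z) (tau i z))%R)%E) :
  forall x : R -> R, solution p tau x -> oscillatory x.
Proof.
(* The equation is linear, so excluding eventually positive solutions and applying this to [- x]
   excludes negative ones too. [T0] stands for [tau_inv tau T1]. *)
have not_pos x dx T0 : {within `[T0, +oo[, continuous dx} ->
    (forall t, T0 <= t -> has_deriv_within `[T0, +oo[ x t (dx t) /\
      dx t + \sum_(i < m.+1) p i t * x (tau i t) = 0) ->
    ~ \forall t \near +oo, 0 < x t.
  (* The bound [T0 + 1] keeps all later times in the interior of the half-line, where derivatives
     are two-sided. *)
  move=> dx_cont x_eqn /(@near_pinfty_ge _ _ (Num.max 0 (T0 + 1)))[N].
  rewrite ge_max => /andP[N0 TN] xN.
  have [T NT tauT] := tau_ge N N tau_cvg.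
  have T0T t : T <= t -> T0 < t.
    move=> Tt; rewrite (lt_le_trans _ (le_trans NT Tt))//.
    by rewrite (lt_le_trans _ TN)// ltrDl.
  have nbhsT t : T <= t -> nbhs t `[T0, +oo[%classic.
    move=> /T0T Tt; apply: filterS (lt_nbhsr Tt) => z /= /ltW Tz.
    by rewrite in_itv/= andbT.
  have limsup_le l : 1 < l -> l < lambda0 -> (limsup_pinfty (fun t : R =>
      \int[completed_lebesgue_measure]_(z in `[h tau t, t])
        \sum_(i < m.+1) p i z * a p tau r (h tau z) (tau i z))%R
      <= ((1 + ln l) / l)%:E)%E.
    move=> l1 ll0; apply: limsup_le_of_near.
    apply: (@limsup_integral_le _ _ p tau p_ge0 tau_lt tau_cvg int_ok x dx T
      (le_trans N0 NT) _ _ _ _ _ alpha lambda0) => //.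
    - by move=> t Tt; apply: xN; exact: le_trans Tt.
    - by move=> t i Tt; apply: xN; exact: tauT.
    - move=> t Tt; have [xd _] := x_eqn t (ltW (T0T t Tt)).
      by apply: is_derive_of_within xd; exact: nbhsT.
    - move=> t Tt; have := dx_cont; rewrite continuous_within_itvcyP.
      by move=> [+ _]; apply; rewrite in_itv/= andbT; exact: T0T.
    - move=> t Tt; have [_ /eqP] := x_eqn t (ltW (T0T t Tt)).
      by rewrite addr_eq0 => /eqP ->; rewrite opprK.
    - move=> b bal; have := near_ge_of_lt_liminf alphaE bal.
      by move=> /(@near_pinfty_ge _ _ 0)[S _ bS]; exists S.
  have l01 := lambda0_gt1 alpha_gt0 lambda0_root.
  pose phi (l : R) : R := (1 + ln l) / l.
  have phi_cvg : phi l @[l --> lambda0^'-] --> phi lambda0.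
    have l00 : 0 < lambda0 by apply: lt_trans l01.
    apply: cvg_at_left_filter; apply: cvgM.
      by apply: cvgD; [exact: cvg_cst|exact: continuous_ln].
    by apply: cvgV; [exact: lt0r_neq0|exact: cvg_id].
  (* The upper limit may be [+oo]; a finite [q] above [phi lambda0] and not exceeding it serves both
     cases. *)
  have [q phiq qlim] : exists2 q : R, phi lambda0 < q &
      (q%:E <= limsup_pinfty (fun t : R =>
         \int[completed_lebesgue_measure]_(z in `[h tau t, t])
           \sum_(i < m.+1) p i z * a p tau r (h tau z) (tau i z))%R)%E.
    case: limsup_pinfty limsup_gt => [q|_|//].
      by rewrite lte_fin; exists q.
    by exists (phi lambda0 + 1); rewrite ?ltrDl ?leey.
  (* By continuity [phi l < q] for [l] just below [lambda0], whereas [limsup_le] forces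
     [q <= phi l]. *)
  near lambda0^'- => l.
  have : phi l < q by near: l; exact: (cvgr_lt _ phi_cvg).
  apply/negP; rewrite -leNgt -lee_fin; apply: le_trans qlim _; apply: limsup_le.
    by near: l; exact: nbhs_left_gt.
  by near: l; exact: nbhs_left_lt.
move=> x [T1 [_ [_ [dx [dx_cont x_eqn]]]]]; split.
  exact: not_pos dx_cont x_eqn.
move=> x_lt0.
apply: (not_pos (fun t => - x t) (fun t => - dx t) (tau_inv tau T1)).
- by move=> t; apply: cvgN; exact: dx_cont.
- move=> t Tt; have [xd xE] := x_eqn t Tt; split.
    have E : (fun z => (- x z - - x t) / (z - t)) =
        (fun z => - ((x z - x t) / (z - t))).
      by apply/funext => z; rewrite -mulNr opprB opprK addrC.
    by rewrite /has_deriv_within E; apply: cvgN.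
  under eq_bigr do rewrite mulrN.
  by rewrite sumrN -opprD xE oppr0.
- by apply: filterS x_lt0 => t; rewrite oppr_gt0.
Unshelve. all: by end_near. Qed.
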